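(* The planar tree fertility map $\Phi_{\mathrm{fer}}^{\mathcal T}:\mathbf{k}\,\mathcal{OT}^A\to V(A)$ is a linear isomorphism onto $V(A)$.
   Context: $\mathbf{k}$ is a field of characteristic zero and $A$ is a finite set. $\mathcal Z_A=\{z_i^a \mid a\in A,\ i\in\mathbb Z_{\ge -1}\}$ and $\overline{\mathrm{PN}}(A)=\mathbf{k}\langle \mathcal Z_A\rangle$ is the free unital associative algebra on $\mathcal Z_A$. $V(A)\subseteq\overline{\mathrm{PN}}(A)$ is the linear span of the monomials (words) $z_{i_1}^{a_1}\cdots z_{i_p}^{a_p}$ with $\sum_{r=1}^p i_r=-1$ and $\sum_{r=1}^q i_r\ge 0$ for all $1\le q<p$. $\mathcal{OT}^A$ is the set of (nonempty, finite) planar rooted trees with vertices decorated by elements of $A$, and $\mathbf{k}\,\mathcal{OT}^A$ the vector space with basis $\mathcal{OT}^A$. The root-subtree order on the vertex set of a planar rooted tree $t$ is defined recursively: the root comes first, followed by the vertices of the subtrees attached to the root, taken from left to right, each subtree being ordered recursively by the same rule. For a vertex $v$, $d(v)\in A$ is its decoration and the fertility $f(v)$ is its number of children. If $v_1<\dots<v_p$ are the vertices of $t\in\mathcal{OT}^A$ in root-subtree order, the planar tree fertility map is the linear map with $$\Phi_{\mathrm{fer}}^{\mathcal T}(t)=z_{f(v_1)-1}^{d(v_1)}\cdots z_{f(v_p)-1}^{d(v_p)}.$$ *)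

(* Defs.v *)
From HB Require Import structures.
From mathcomp Require Import all_boot all_order all_algebra.
From mathcomp Require Import finmap.
From mathcomp.multinomials Require Import monalg.

Set Implicit Arguments.
Unset Strict Implicit.
Unset Printing Implicit Defensive.

Import Order.TTheory GRing.Theory Num.Theory.

Local Open Scope ring_scope.

(* Siblings are ordered from left to right. *)
Inductive planar_tree (A : Type) : Type :=
  Node of A & seq (planar_tree A).

Section PlanarTree.
Variable A : Type.
Implicit Type t : planar_tree A.

Definition subtrees t : seq (planar_tree A) := let: Node _ s := t in s.

(* The vertices of [t] in root-subtree order. A vertex is given by the full   *)
(* subtree it roots; the list has exactly one entry per vertex, so equal      *)
(* subtrees rooted at different vertices are repeated.                        *)
Fixpoint vertices t : seq (planar_tree A) :=
  let: Node _ s := t in t :: flatten (map vertices s).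

Definition deco (v : planar_tree A) : A := let: Node a _ := v in a.
Definition fertility (v : planar_tree A) : nat := size (subtrees v).

Fixpoint tree_encode t : GenTree.tree A :=
  let: Node a s := t in GenTree.Node 0 (GenTree.Leaf a :: map tree_encode s).

Fixpoint tree_decode (g : GenTree.tree A) : option (planar_tree A) :=
  if g is GenTree.Node _ (GenTree.Leaf a :: s)
  then Some (Node a (pmap tree_decode s)) else None.

Lemma tree_encodeK : pcancel tree_encode tree_decode.
Proof.
rewrite /pcancel; fix IH 1 => -[a s] /=; congr (Some (Node a _)).
by elim: s => //= t s ->; rewrite IH.
Qed.
End PlanarTree.

HB.instance Definition _ (A : choiceType) :=
  Choice.copy (planar_tree A) (pcan_type (@tree_encodeK A)).

Definition kOT (k : fieldType) (A : finType) := {malg k[planar_tree A]}.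

Definition zidx : choiceType := {i : int | -1 <= i}.

Lemma zidx_subproof (n : nat) : -1 <= n%:Z - 1.
Proof. by rewrite lerBrDr addNr. Qed.

Definition zidx_pred (n : nat) : zidx :=
  exist (fun i : int => -1 <= i) (n%:Z - 1) (zidx_subproof n).

(* The letter (a, i) is the index of the generator z_i^a. *)
Definition letter (A : finType) : choiceType := (A * zidx)%type.

Definition PN (k : fieldType) (A : finType) := {malg k[{fmonom (letter A)}]}.

Section Fertility.
Variables (k : fieldType) (A : finType).

Definition z (x : letter A) : PN k A := << fmu x >>.

Definition word (w : seq (letter A)) : PN k A := \prod_(x <- w) z x.

Definition weight (w : seq (letter A)) : int := \sum_(x <- w) val x.2.

Definition V_word (w : seq (letter A)) : Prop :=
  weight w = -1 /\
  (forall q : nat, (1 <= q < size w)%N -> 0 <= weight (take q w)).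

Definition V (p : PN k A) : Prop :=
  exists s : seq (k * seq (letter A)),
    (forall x, x \in s -> V_word x.2) /\ p = \sum_(x <- s) x.1 *: word x.2.

Definition tree_word (t : planar_tree A) : PN k A :=
  \prod_(v <- vertices t) z (deco v, zidx_pred (fertility v)).

Definition Phi_fer (p : kOT k A) : PN k A :=
  \sum_(t <- msupp p) p@_t *: tree_word t.

Lemma Phi_ferU (t : planar_tree A) : Phi_fer << t >> = tree_word t.
Proof. by rewrite /Phi_fer msuppU oner_eq0 big_seq_fset1 mcoeffUU scale1r. Qed.
End Fertility.

(* Main.v *)
Require Import Defs.
From HB Require Import structures.
From mathcomp Require Import all_boot all_order all_algebra.
From mathcomp Require Import finmap zify.
From mathcomp.multinomials Require Import monalg.

(** The map sends the basis of trees to the family of words that spans [V].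
    Words are pairwise distinct basis elements of the free algebra, so everything
    reduces to one combinatorial fact: reading decorations and fertilities in
    root-subtree order is a bijection from trees to the words of [V] (this is
    Lukasiewicz's coding of planar trees).

    It is easier to prove the bijection for forests with [n] trees, against the
    words of weight [- n] whose proper prefixes all weigh more than [- n]. Deleting
    the first root of a forest replaces its tree by the list of its children, and
    deletes exactly the first letter of the word of the forest:
    [forest_word (Node a c :: s) = (a, |c| - 1) :: forest_word (c ++ s)].
    So the three ingredients follow by induction along this operation: the weight
    and prefix conditions ([weight_forest_word], [weight_take_forest_word]),
    injectivity ([forest_word_inj], since the first letter tells where to cut
    [c ++ s]), and surjectivity ([forest_word_surj], which rebuilds the first tree
    from as many trees of the remaining forest as that letter prescribes).

    Injectivity of the linear map then follows because the coefficient of [t] in [p]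
    is the coefficient of the word of [t] in the image ([mcoeff_Phi_fer]);
    surjectivity holds because every spanning word of [V] is the image of a
    tree. *)

Set Implicit Arguments.
Unset Strict Implicit.
Unset Printing Implicit Defensive.

Import Order.TTheory GRing.Theory Num.Theory.

Local Open Scope ring_scope.

(** * Words of planar forests *)

Section ForestWord.
Variable A : finType.
Implicit Types (a : A) (c s : seq (planar_tree A)) (t : planar_tree A).
Implicit Types (w : seq (letter A)).

Definition forest_word s : seq (letter A) :=
  [seq (deco v, zidx_pred (fertility v)) | v <- flatten (map (@vertices A) s)].

Lemma forest_word_cons a c s :
  forest_word (Node a c :: s) =
  (a, zidx_pred (size c)) :: forest_word (c ++ s).
Proof. by rewrite /forest_word /= -flatten_cat -map_cat. Qed.

(** Deleting the first root is well-founded, because it removes a vertex. This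
    replaces the nested induction that the type of planar trees would require. *)
Lemma forest_ind (P : seq (planar_tree A) -> Prop) :
  P [::] -> (forall a c s, P (c ++ s) -> P (Node a c :: s)) -> forall s, P s.
Proof.
move=> P0 PS s; have [n] := ubnP (size (forest_word s)).
elim: n s => // n IHn [//|[a c] s]; rewrite forest_word_cons ltnS => lt_n.
exact/PS/IHn.
Qed.

Lemma zidx_pred_inj : injective zidx_pred.
Proof. by move=> m n /(congr1 val) /= /addIr []. Qed.

Lemma zidx_predP (i : zidx) : exists n, i = zidx_pred n.
Proof.
exists (absz (val i + 1)); apply: val_inj => /=.
by have := valP i; rewrite /=; lia.
Qed.

Lemma weight_cons (x : letter A) w : weight (x :: w) = val x.2 + weight w.
Proof. by rewrite /weight big_cons. Qed.

Lemma weight_nil : weight ([::] : seq (letter A)) = 0.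
Proof. by rewrite /weight big_nil. Qed.

Lemma weight_forest_word s : weight (forest_word s) = - (size s)%:Z.
Proof.
elim/forest_ind: s => [|a c s IHs]; first exact: weight_nil.
by rewrite forest_word_cons weight_cons IHs size_cat /=; lia.
Qed.

Lemma weight_take_forest_word s q : (q < size (forest_word s))%N ->
  - (size s)%:Z < weight (take q (forest_word s)).
Proof.
elim/forest_ind: s q => [//|a c s IHs] [|q].
  by rewrite take0 weight_nil /=; lia.
rewrite forest_word_cons /= ltnS => /IHs.
by rewrite weight_cons size_cat /=; lia.
Qed.

Lemma forest_word_inj : injective forest_word.
Proof.
move=> s; elim/forest_ind: s => [|a c s IHs] [|[a' c'] s'] //.
rewrite !forest_word_cons => /eqP; rewrite eqseq_cons xpair_eqE -andbA.
case/and3P=> /eqP <- /eqP/zidx_pred_inj eq_size /eqP/IHs/eqP.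
by rewrite eqseq_cat // => /andP[/eqP -> /eqP ->].
Qed.

(** The prefix condition is what makes the construction possible: on the empty
    prefix it says that [n] is positive, so that the forest obtained for the tail
    contains enough trees to serve as the children of the new root. *)
Lemma forest_word_surj w (n : nat) : weight w = - n%:Z ->
  (forall q, (q < size w)%N -> - n%:Z < weight (take q w)) ->
  exists2 s, forest_word s = w & size s = n.
Proof.
elim: w n => [|[a i] w IHw] n wt_w pfx_w.
  by exists [::] => //=; move: wt_w; rewrite weight_nil; lia.
have n_gt0 : (0 < n)%N.
  by have := pfx_w 0%N isT; rewrite take0 weight_nil; lia.
have [m def_i] := zidx_predP i; subst i.
have [||s def_w size_s] := IHw (m + n.-1)%N.
- by move: wt_w; rewrite weight_cons /=; lia.
- move=> q lt_q; have := pfx_w q.+1 lt_q.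
  by rewrite /= weight_cons /=; lia.
have size_c : size (take m s) = m by rewrite size_takel // size_s leq_addr.
exists (Node a (take m s) :: drop m s).
  by rewrite forest_word_cons cat_take_drop def_w size_c.
by rewrite /= size_drop size_s; lia.
Qed.

Lemma V_word_forest_word1 t : V_word (forest_word [:: t]).
Proof.
split=> [|q /andP[_ lt_q]]; first exact: weight_forest_word.
by have := weight_take_forest_word lt_q; rewrite /=; lia.
Qed.

Lemma V_word_tree w : V_word w -> exists t, forest_word [:: t] = w.
Proof.
move=> [wt_w pfx_w].
have [|[|t [|//]] // <- _] := @forest_word_surj w 1%N wt_w; last by exists t.
case=> [|q] lt_q; first by rewrite take0 weight_nil.
by have := pfx_w q.+1 lt_q; lia.
Qed.

End ForestWord.

(** * The linear map *)

Section FertilityMap.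
Variables (k : fieldType) (A : finType).
Implicit Types (t : planar_tree A) (p : kOT k A).

Lemma wordE (w : seq (letter A)) : word k w = << FMonom w >>.
Proof.
elim: w => [|x w IHw]; first by rewrite /word big_nil -fmoneE.
rewrite /word big_cons -/(word k w) IHw /z malgM_def fgmulUU mulr1.
by congr << _ >>; apply/eqP; rewrite fmP fmM fmU.
Qed.

Lemma tree_wordE t : tree_word k t = word k (forest_word [:: t]).
Proof. by rewrite /tree_word /word /forest_word /= cats0 big_map. Qed.

(** The defining sum ranges over a support that depends on the argument;
    enlarging it to a common set is what makes linearity a termwise check. *)
Lemma Phi_ferEw (d : {fset planar_tree A}) p : (msupp p `<=` d)%fset ->
  Phi_fer p = \sum_(t <- d) p@_t *: tree_word k t.
Proof.
move=> le_d; rewrite /Phi_fer (big_fset_incl _ le_d) //= => t _ t_out.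
by rewrite mcoeff_outdom // scale0r.
Qed.

Lemma Phi_fer_linear : linear (@Phi_fer k A : kOT k A -> PN k A).
Proof.
move=> c p q; pose d := (msupp (c *: p + q) `|` (msupp p `|` msupp q))%fset.
have le_pq : (msupp p `|` msupp q `<=` d)%fset by apply: fsubsetUr.
rewrite !(@Phi_ferEw d) ?fsubsetUl //; first last.
- exact: fsubset_trans (fsubsetUl _ _) le_pq.
- exact: fsubset_trans (fsubsetUr _ _) le_pq.
rewrite scaler_sumr -big_split /=; apply: eq_bigr => t _.
by rewrite mcoeffD mcoeffZ scalerDl scalerA.
Qed.

(** Distinct trees have distinct words, so only [t] itself contributes to the
    coefficient of its word. *)
Lemma mcoeff_Phi_fer p t : (Phi_fer p)@_(FMonom (forest_word [:: t])) = p@_t.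
Proof.
rewrite [in RHS](monalgE p) /Phi_fer !raddf_sum /=; apply: eq_bigr => t' _.
rewrite tree_wordE wordE mcoeffZ !mcoeffU mulr_natr; congr (_ *+ nat_of_bool _).
rewrite fmP /=; apply/eqP/eqP => [/forest_word_inj[]|->] //.
Qed.

Lemma Phi_fer_inj : injective (@Phi_fer k A).
Proof. by move=> p q eq_pq; apply/malgP => t; rewrite -!mcoeff_Phi_fer eq_pq. Qed.

Lemma Phi_fer_in_V p : V (Phi_fer p).
Proof.
exists [seq (p@_t, forest_word [:: t]) | t <- msupp p]; split.
  by move=> _ /mapP[t _ ->]; apply: V_word_forest_word1.
by rewrite big_map; apply: eq_bigr => t _; rewrite tree_wordE.
Qed.

Lemma Phi_fer_onto_V (v : PN k A) : V v -> exists p, Phi_fer p = v.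
Proof.
move=> [s [+ ->]]; elim: s => [_|[c w] s IHs Vs].
  by exists 0; rewrite big_nil /Phi_fer msupp0 big_seq_fset0.
have [|p def_p] := IHs; first by move=> x xs; apply: Vs; rewrite inE xs orbT.
have [t def_w] := V_word_tree (Vs (c, w) (mem_head _ _)).
exists (c *: << t >> + p).
by rewrite Phi_fer_linear Phi_ferU tree_wordE def_w def_p big_cons.
Qed.

End FertilityMap.

Theorem proposition2p12 (k : fieldType) (chark0 : [pchar k] =i pred0)
    (A : finType) :
  [/\ linear (@Phi_fer k A : kOT k A -> PN k A),
      (forall x : kOT k A, V (Phi_fer x)),
      injective (@Phi_fer k A)
    & (forall v : PN k A, V v -> exists x : kOT k A, Phi_fer x = v)].
Proof.
split; [exact: Phi_fer_linear | exact: Phi_fer_in_V | exact: Phi_fer_inj |].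
exact: Phi_fer_onto_V.
Qed.
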